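(* Let $\mathbf{M}_1$ be a finite total structure of finite type and let $\mathbf{M}_2$ be a total structure (on the same set $M$) compatible with $\mathbf{M}_1$. Define $\mathcal{A}=\mathsf{ISP}(\mathbf{M}_1)$, $\mathcal{A}_{\mathscr{T}}=\mathsf{IS}_{\mathrm c}\mathsf{P}(\mathbf{M}_1^{\mathscr{T}})$, $\mathcal{X}=\mathsf{IS}^0\mathsf{P}^+(\mathbf{M}_2)$ and $\mathcal{X}_{\mathscr{T}}=\mathsf{IS}^0_{\mathrm c}\mathsf{P}^+(\mathbf{M}_2^{\mathscr{T}})$. Assume that $\mathbf{M}_2^{\mathscr{T}}$ yields a full duality between $\mathcal{A}$ and $\mathcal{X}_{\mathscr{T}}$. Then $\mathbf{M}_2$ yields a full duality between $\mathcal{A}_{\mathscr{T}}$ and $\mathcal{X}$ and (1) $n_{\mathcal{A}}(\mathbf{A})=\mathrm{G}(\mathrm{D}(\mathbf{A})^\flat)$ for all $\mathbf{A}\in\mathcal{A}$, and $n_{\mathcal{X}}(\mathbf{X})=\mathrm{D}(\mathrm{G}(\mathbf{X})^\flat)$ for all $\mathbf{X}\in\mathcal{X}$; (2) $n_{\mathcal{A}}(\mathbf{A})$ consists of all maps $\mathcal{A}(\mathbf{A},\mathbf{M}_1)\to M$ that preserve the structure on $\mathbf{M}_2$, for all $\mathbf{A}\in\mathcal{A}$; (3) $n_{\mathcal{X}}(\mathbf{X})$ consists of all maps $\mathcal{X}(\mathbf{X},\mathbf{M}_2)\to M$ that preserve the structure on $\mathbf{M}_1$, for all $\mathbf{X}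\in\mathcal{X}$.
   Context: A total structure $\mathbf{A}=\langle A;G,R\rangle$ is a set with a set $G$ of finitary (total) operations and a set $R$ of finitary relations; it is of finite type if $G$ and $R$ are finite. Products are formed coordinatewise; a substructure is a subset closed under the operations, with restricted structure; homomorphisms preserve operations and relations. $^\flat$ forgets the topology. Let $\mathbf{M}_1=\langle M;G_1,R_1\rangle$ and $\mathbf{M}_2=\langle M;G_2,R_2\rangle$ be total structures on the same finite set $M$. $\mathbf{M}_2$ is compatible with $\mathbf{M}_1$ if each operation in $G_2$ is a homomorphism with respect to $\mathbf{M}_1$ and each relation in $R_2$ is a substructure of the appropriate power of $\mathbf{M}_1$ (this relation is symmetric). $\mathbf{M}_i^{\mathscr{T}}$ is $\mathbf{M}_i$ with the discrete topology. Class operators: $\mathsf{ISP}$: isomorphic copies of non-empty substructures of powers; $\mathsf{IS}_{\mathrm c}\mathsf{P}$: isomorphic copies of non-empty topologically closed substructures of powers; superscript $0$ on $\mathsf{S}$ means the empty substructure is also allowed (when there are no nullary operations); $\mathsf{P}^+$ means that only powers with non-empty index set are used. Morphisms are homomorphisms, continuous in the topological case. Hom-functors: $\mathrm{D}(\mathbf{A}):=\mathcal{A}(\mathbf{A},\mathbf{M}_1)\le(\mathbf{M}_2^{\mathscr{T}})^A$ for $\mathbf{A}\in\mathcal{A}$; $\mathrm{E}(\mathbf{X}):=\mathcal{X}_{\mathscr{T}}(\mathbf{X},\mathbf{M}_2^{\mathscr{T}})\le\mathbf{M}_1^X$ for $\mathbf{X}\in\mathcal{X}_{\mathscr{T}}$;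 $\mathrm{F}(\mathbf{A}):=\mathcal{A}_{\mathscr{T}}(\mathbf{A},\mathbf{M}_1^{\mathscr{T}})\le\mathbf{M}_2^A$ for $\mathbf{A}\in\mathcal{A}_{\mathscr{T}}$; $\mathrm{G}(\mathbf{X}):=\mathcal{X}(\mathbf{X},\mathbf{M}_2)\le(\mathbf{M}_1^{\mathscr{T}})^X$ for $\mathbf{X}\in\mathcal{X}$. $\mathbf{M}_2^{\mathscr{T}}$ yields a full duality between $\mathcal{A}$ and $\mathcal{X}_{\mathscr{T}}$ if the evaluation maps $\mathbf{A}\to\mathrm{E}(\mathrm{D}(\mathbf{A}))$ and $\mathbf{X}\to\mathrm{D}(\mathrm{E}(\mathbf{X}))$ are isomorphisms for all $\mathbf{A}\in\mathcal{A}$, $\mathbf{X}\in\mathcal{X}_{\mathscr{T}}$. $\mathbf{M}_2$ yields a full duality between $\mathcal{A}_{\mathscr{T}}$ and $\mathcal{X}$ if the evaluation maps $\mathbf{A}\to\mathrm{G}(\mathrm{F}(\mathbf{A}))$ and $\mathbf{X}\to\mathrm{F}(\mathrm{G}(\mathbf{X}))$ are isomorphisms for all $\mathbf{A}\in\mathcal{A}_{\mathscr{T}}$, $\mathbf{X}\in\mathcal{X}$. (Isomorphisms of topological structures where topologies are present.) Natural extensions: for $\mathbf{A}\in\mathcal{A}$, $n_{\mathcal{A}}(\mathbf{A})$ is the topological closure of $\{(x(a))_{x\in\mathcal{A}(\mathbf{A},\mathbf{M}_1)}\mid a\in A\}$ in $(\mathbf{M}_1^{\mathscr{T}})^{\mathcal{A}(\mathbf{A},\mathbf{M}_1)}$;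 for $\mathbf{X}\in\mathcal{X}$, $n_{\mathcal{X}}(\mathbf{X})$ is the topological closure of $\{(\varphi(x))_{\varphi\in\mathcal{X}(\mathbf{X},\mathbf{M}_2)}\mid x\in X\}$ in $(\mathbf{M}_2^{\mathscr{T}})^{\mathcal{X}(\mathbf{X},\mathbf{M}_2)}$. A map $\mathcal{A}(\mathbf{A},\mathbf{M}_1)\to M$ preserves the structure on $\mathbf{M}_2$ if it is a homomorphism into $\mathbf{M}_2$ when $\mathcal{A}(\mathbf{A},\mathbf{M}_1)$ is regarded as a substructure of $\mathbf{M}_2^A$; a map $\mathcal{X}(\mathbf{X},\mathbf{M}_2)\to M$ preserves the structure on $\mathbf{M}_1$ if it is a homomorphism into $\mathbf{M}_1$ when $\mathcal{X}(\mathbf{X},\mathbf{M}_2)$ is regarded as a substructure of $\mathbf{M}_1^X$. *)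

(* Defs.v *)
From mathcomp Require Import all_boot all_classical topology.

Set Implicit Arguments.
Unset Strict Implicit.
Unset Printing Implicit Defensive.

Local Open Scope classical_set_scope.

Record signature := Signature {
  ops : Type;
  op_arity : ops -> nat;
  rels : Type;
  rel_arity : rels -> nat }.

Definition finite_type (S : signature) :=
  finite_set [set: ops S] /\ finite_set [set: rels S].

(* An n-tuple of elements of T is a function 'I_n -> T, so that the n-th power
   of a structure is its power with exponent 'I_n. *)
Record structure (S : signature) (T : Type) := Structure {
  op_of : forall g : ops S, ('I_(op_arity g) -> T) -> T;
  rel_of : forall r : rels S, set ('I_(rel_arity r) -> T) }.
Arguments op_of {S T} A g xs : rename.
Arguments rel_of {S T} A r : rename.

Definition power S T (A : structure S T) (I : Type) : structure S (I -> T) := {|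
  op_of g xs := fun i => op_of A g (fun k => xs k i);
  rel_of r := [set xs | forall i, rel_of A r (fun k => xs k i)] |}.

Definition hom S T U (A : structure S T) (B : structure S U) (f : T -> U) :=
  (forall (g : ops S) xs, f (op_of A g xs) = op_of B g (f \o xs)) /\
  (forall (r : rels S) xs, rel_of A r xs -> rel_of B r (f \o xs)).

Definition iso S T U (A : structure S T) (B : structure S U) (f : T -> U) :=
  hom A B f /\
  exists g : U -> T, [/\ cancel f g, cancel g f & hom B A g].

Definition top_iso S (X Y : topologicalType) (A : structure S X)
    (B : structure S Y) (f : X -> Y) :=
  [/\ hom A B f, continuous f &
  exists g : Y -> X, [/\ cancel f g, cancel g f, hom B A g & continuous g]].

Definition op_closed S T (A : structure S T) (B : set T) :=
  forall (g : ops S) xs, (forall k, B (xs k)) -> B (op_of A g xs).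

Record substructure S T (A : structure S T) := Substructure {
  sub_set :> set T;
  sub_closed : op_closed A sub_set }.

Definition induced S T (A : structure S T) (B : substructure A) :
    structure S (set_type B) := {|
  op_of g xs := exist _ (op_of A g (fun k => val (xs k)))
    (mem_set (sub_closed (fun k => set_valP (xs k))));
  rel_of r := [set xs | rel_of A r (fun k => val (xs k))] |}.
Coercion induced : substructure >-> structure.

(* compatible M1 M2: M2 is compatible with M1 *)
Definition compatible S1 S2 M (M1 : structure S1 M) (M2 : structure S2 M) :=
  (forall g : ops S2, hom (power M1 'I_(op_arity g)) M1 (op_of M2 g)) /\
  (forall r : rels S2, op_closed (power M1 'I_(rel_arity r)) (rel_of M2 r)).

Lemma compatible_sym S1 S2 M (M1 : structure S1 M) (M2 : structure S2 M) :
  compatible M1 M2 -> compatible M2 M1.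
Proof.
move=> [cop crel]; split=> [g|r]; first split=> [h xs|r xs rxs].
- by have [/(_ g (fun j i => xs i j)) <-] := cop h.
- by apply: crel => k; exact: rxs.
- move=> g xs rxs; have [_ /(_ r (fun j i => xs i j))] := cop g; exact.
Qed.

(* M^I, the product of I copies of the discrete space M *)
Definition power_space (M : finType) (I : Type) : topologicalType :=
  {ptws I -> discrete_topology M}.

Definition sub_space S (M : finType) (M1 : structure S M) (I : Type)
    (B : substructure (power M1 I)) : topologicalType :=
  set_type (B : set (power_space M I)).

(* In each of the classes below, [set: I] !=set0 is the requirement P^+ and
   B !=set0 is dropped exactly for S^0. As B is closed under all operations, it
   can be empty only if there are no nullary ones. *)
Section Classes.
Context S (M : finType) (M1 : structure S M).

Definition ISP (T : Type) (A : structure S T) :=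
  exists (I : Type) (B : substructure (power M1 I)),
    B !=set0 /\ exists f : T -> B, iso A B f.

Definition IScP (X : topologicalType) (A : structure S X) :=
  exists (I : Type) (B : substructure (power M1 I)),
    [/\ B !=set0, closed (B : set (power_space M I)) &
    exists f : X -> sub_space B, @top_iso S X (sub_space B) A B f].

Definition IS0Pplus (T : Type) (A : structure S T) :=
  exists (I : Type) (B : substructure (power M1 I)),
    [set: I] !=set0 /\ exists f : T -> B, iso A B f.

Definition IS0cPplus (X : topologicalType) (A : structure S X) :=
  exists (I : Type) (B : substructure (power M1 I)),
    [/\ [set: I] !=set0, closed (B : set (power_space M I)) &
    exists f : X -> sub_space B, @top_iso S X (sub_space B) A B f].

End Classes.

Lemma nbhs_power_space (M : finType) (I : Type) (f : power_space M I)
    (U : set (power_space M I)) :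
  nbhs f U <-> exists J : seq {classic I},
    forall h : I -> M, (forall j, j \in J -> h j = f j) -> U h.
Proof.
split; last first.
  move=> [J JU].
  suff : nbhs f [set h | forall j, j \in J -> h j = f j].
    by apply: filterS => h; exact: JU.
  elim: J {JU} => [|j J IH]; first by apply: filterS filterT.
  have nj : nbhs f [set h | h j = f j].
    exact: (@proj_continuous {classic I} (fun=> discrete_topology M) j f)
      (@discrete_set1 (discrete_topology M) (f j)).
  apply: filterS (filterI nj IH) => h [/= hj hJ] k.
  by rewrite in_cons => /orP[/eqP ->|/hJ].
pose F : set_system (power_space M I) := fun V => exists J : seq {classic I},
  forall h : I -> M, (forall j, j \in J -> h j = f j) -> V h.
have FF : Filter F.
  split=> [|P Q [J JP] [K KQ]|P Q PQ [J JP]].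
  - by exists [::].
  - exists (J ++ K) => h hE; split.
      by apply: JP => j jJ; apply: hE; rewrite mem_cat jJ.
    by apply: KQ => j jK; apply: hE; rewrite mem_cat jK orbT.
  - by exists J => h /JP; exact: PQ.
suff : F --> f by exact.
apply/cvg_sup => i V [_ [[W _ <-] /= Wf WV]].
by exists [:: i] => h hE; apply: WV; rewrite /= hE // inE.
Qed.

Section HomFunctors.
Context S1 S2 (M : finType) (M1 : structure S1 M) (M2 : structure S2 M).
Hypothesis c : compatible M1 M2.

Lemma hom_closed T (A : structure S1 T) :
  op_closed (power M2 T) [set f : T -> M | hom A M1 f].
Proof.
move=> g fs fsP; have [gop grel] := c.1 g; split=> [h xs|r xs rxs] /=.
  rewrite -[RHS]gop /=; congr (op_of M2 _ _); apply/funext => k.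
  by rewrite (fsP k).1.
by apply: grel => k; exact: (fsP k).2.
Qed.

Lemma chom_closed (X : topologicalType) (A : structure S1 X) :
  op_closed (power M2 X) [set f : X -> M |
    hom A M1 f /\ continuous (f : X -> discrete_topology M)].
Proof.
move=> g fs fsP; split; first by apply: hom_closed => k; exact: (fsP k).1.
move=> x; apply/discrete_cvg.
have : \forall y \near x, forall k, fs k y = fs k x.
  apply: filter_forall => k.
  exact: (fsP k).2 x _ (@discrete_set1 (discrete_topology M) (fs k x)).
by apply: filterS => y E /=; congr (op_of M2 _ _); apply/funext => k.
Qed.

(* the set of homomorphisms A -> M1 as a substructure of M2^A *)
Definition homs T (A : structure S1 T) : substructure (power M2 T) :=
  Substructure (@hom_closed T A).

Definition chomts (X : topologicalType) (A : structure S1 X) :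
    substructure (power M2 X) :=
  Substructure (@chom_closed X A).

Definition evaluations T (A : structure S1 T) : set (homs A -> M) :=
  [set (fun x : homs A => val x a) | a in [set: T]].
Arguments evaluations {T} A.

Lemma closure_evaluations_closed T (A : structure S1 T) :
  op_closed (power M1 (homs A))
    (closure (evaluations A : set (power_space M (homs A)))).
Proof.
move=> g ps clps U /nbhs_power_space[J JU].
have /choice[a aP] : forall k, exists a : T, forall j, j \in J ->
    val (j : homs A) a = ps k j.
  move=> k; have [|h [[a _ <-] hE]] := clps k
    [set h | forall j, j \in J -> h j = ps k j].
    by apply/nbhs_power_space; exists J.
  by exists a.
exists (fun x : homs A => val x (op_of A g a)); split; first by exists (op_of A g a).
apply: JU => j jJ; have [+ _] : hom A M1 (val j) := set_valP j.
by move=> ->; congr (op_of M1 _ _); apply/funext => k /=; exact: aP.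
Qed.

Definition nat_ext T (A : structure S1 T) : substructure (power M1 (homs A)) :=
  Substructure (@closure_evaluations_closed T A).

End HomFunctors.

Arguments chomts {S1 S2 M M1 M2} c {X} A.

Section Evaluation.
Context S1 S2 (M : finType) (M1 : structure S1 M) (M2 : structure S2 M).
Hypotheses (c12 : compatible M1 M2) (c21 : compatible M2 M1).

Lemma evaluation_hom S (N : structure S M) T (B : substructure (power N T))
  (a : T) : hom B N (fun x : B => val x a).
Proof. by split=> // r xs; exact. Qed.

Lemma evaluation_continuous S (N : structure S M) T
    (B : substructure (power N T)) (a : T) :
  continuous ((fun x => val x a) : sub_space B -> discrete_topology M).
Proof.
move=> x.
apply: (@continuous_comp (sub_space B) (power_space M T) (discrete_topology M)
  set_val (fun f => f a)).
  exact: (@initial_continuous _ (power_space M T) set_val x).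
exact: (@proj_continuous {classic T} (fun=> discrete_topology M) a).
Qed.

Definition eval_hom_chom T (A : structure S1 T) (a : T) :
    chomts c21 (homs c12 A : structure S2 (sub_space (homs c12 A))) :=
  exist _ (fun x : homs c12 A => val x a)
    (mem_set (conj (@evaluation_hom _ _ _ (homs c12 A) a)
                   (@evaluation_continuous _ _ _ (homs c12 A) a))).

Definition eval_chom_hom (X : topologicalType) (A : structure S1 X) (a : X) :
    homs c21 (chomts c12 A) :=
  exist _ (fun x : chomts c12 A => val x a)
    (mem_set (@evaluation_hom _ _ _ (chomts c12 A) a)).

End Evaluation.

Section FullDuality.
Context S1 S2 (M : finType) (M1 : structure S1 M) (M2 : structure S2 M).
Hypothesis c : compatible M1 M2.

Definition D T (A : structure S1 T) : substructure (power M2 T) :=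
  homs c A.
Definition G T (X : structure S2 T) : substructure (power M1 T) :=
  homs (compatible_sym c) X.
Definition F (T : topologicalType) (A : structure S1 T) :
  substructure (power M2 T) := chomts c A.
Definition E (T : topologicalType) (X : structure S2 T) :
  substructure (power M1 T) := chomts (compatible_sym c) X.

(* DT A and GT X live on topological spaces; D A and G X, used as structures,
   are the same with the topology forgotten. *)
Definition DT T (A : structure S1 T) : structure S2 (sub_space (D A)) := D A.
Definition GT T (X : structure S2 T) : structure S1 (sub_space (G X)) := G X.

Definition eval_ED T (A : structure S1 T) : T -> E (DT A) :=
  eval_hom_chom c (compatible_sym c) A.
Definition eval_DE (T : topologicalType) (X : structure S2 T) : T -> D (E X) :=
  eval_chom_hom (compatible_sym c) c X.
Definition eval_GF (T : topologicalType) (A : structure S1 T) : T -> G (F A) :=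
  eval_chom_hom c (compatible_sym c) A.
Definition eval_FG T (X : structure S2 T) : T -> F (GT X) :=
  eval_hom_chom (compatible_sym c) c X.

(* M2 with the discrete topology yields a full duality between ISP(M1) and
   IS0cP+(M2) *)
Definition full_duality_discrete_M2 :=
  (forall T (A : structure S1 T), ISP M1 A -> iso A (E (DT A)) (@eval_ED T A)) /\
  (forall (T : topologicalType) (X : structure S2 T), IS0cPplus M2 X ->
    top_iso X (DT (E X)) (@eval_DE T X)).

(* M2 yields a full duality between IScP(M1) and IS0P+(M2) *)
Definition full_duality_M2 :=
  (forall (T : topologicalType) (A : structure S1 T), IScP M1 A ->
    top_iso A (GT (F A)) (@eval_GF T A)) /\
  (forall T (X : structure S2 T), IS0Pplus M2 X ->
    iso X (F (GT X)) (@eval_FG T X)).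

Definition n_A T (A : structure S1 T) : substructure (power M1 (D A)) :=
  nat_ext c A.
Definition n_X T (X : structure S2 T) : substructure (power M2 (G X)) :=
  nat_ext (compatible_sym c) X.

End FullDuality.

(* Main.v *)
(* Only the restriction of the given duality to finite structures is used.

   Let y_1, ..., y_n : A -> M1 be homomorphisms and B <= M1^n the image of A. An
   M2-homomorphism alpha on D(A) can be pulled back along D(B) -> D(A); as B is
   isomorphic to E(D(B)), the result is an evaluation at a point of B, so alpha
   agrees at y_1, ..., y_n with the evaluation at a point of A. Hence the
   evaluations are dense in G(D(A)). The argument also works for continuous
   homomorphisms y_i, where compactness of A then gives A = G(F(A)), and with
   the roles of M1 and M2 exchanged, where it gives n_X(X) = D(G(X)).

   Let now u : G(X) -> M1 be a continuous homomorphism. By compactness, u factors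
   through the restriction map to some finite substructure X_J of X, via a map
   v : G(X_J) -> M1; it takes one more compactness argument for each relation of
   M1 to enlarge J so that v preserves this relation, and this is where finite
   type is needed. As X_J is finite, v is an evaluation, hence so is u. *)

Require Import Defs.
From mathcomp Require Import all_boot all_classical topology.

Set Implicit Arguments.
Unset Strict Implicit.
Unset Printing Implicit Defensive.

Local Open Scope classical_set_scope.

(** * Compactness of powers of a finite discrete set *)

Lemma power_space_compact (M : finType) (I : Type) :
  compact [set: power_space M I].
Proof.
have := @tychonoff {classic I} (fun=> discrete_topology M) (fun=> setT).
have -> : [set f : {classic I} -> discrete_topology M | forall i, setT (f i)] =
  setT by apply/seteqP; split.
by apply=> i; apply: finite_compact; exact: finite_finset.
Qed.

(** Stands in for subnets in the compactness arguments below: the tails [B J] generate a proper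
    filter, and a neighbourhood of a cluster point fixes finitely many coordinates. *)
Lemma power_space_cluster (M : finType) (K I : Type)
    (w : seq {classic K} -> I -> M) :
  exists w0 : I -> M, forall (J : seq {classic K}) (L : seq {classic I}),
    exists2 J' : seq {classic K}, {subset J <= J'} &
      forall i, i \in L -> w J' i = w0 i.
Proof.
pose B (J : seq {classic K}) : set (power_space M I) :=
  [set w J' | J' in [set J' : seq {classic K} | {subset J <= J'}]].
have FF : ProperFilter (filter_from [set: seq {classic K}] B).
  apply: filter_from_proper => [|J _]; last by exists (w J), J.
  apply: filter_from_filter => [|J1 J2 _ _]; first by exists [::].
  exists (J1 ++ J2) => // _ [J' sJ' <-]; split; exists J' => // j jJ;
    by apply: sJ'; rewrite mem_cat jJ ?orbT.
have [|w0 [_ cl]] := @power_space_compact M I _ FF; first exact: filterT.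
exists w0 => J L.
have [||_ [[J' sJ' <-] wE]] :=
  cl (B J) [set f | forall i, i \in L -> f i = w0 i].
- by exists J.
- by apply/nbhs_power_space; exists L.
by exists J'.
Qed.

Lemma finite_setT_ex_seq (I : Type) : finite_set [set: I] ->
  exists J : seq {classic I}, forall i, i \in J.
Proof.
move=> /(@finite_seqP {classic I})[J JE]; exists J => i.
by have : [set` J] i by rewrite -JE.
Qed.

(** * Topology of subspaces of powers *)

Section Space.
Context S (M : finType) (N : structure S M).

Lemma nbhs_sub_space I (B : substructure (power N I)) (x : sub_space B)
    (U : set (sub_space B)) :
  nbhs x U <-> exists J : seq {classic I},
    forall y : B, (forall j, j \in J -> val y j = val x j) -> U y.
Proof.
split=> [[_ [[V oV <-] /= Vx VU]]|[J JU]].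
  have /nbhs_power_space[J JV] : nbhs (val x : power_space M I) V.
    by apply: open_nbhs_nbhs.
  by exists J => y yE; apply: VU; exact: JV.
have xJ : nbhs (val x : power_space M I)
    [set f | forall j, j \in J -> f j = val x j].
  by apply/nbhs_power_space; exists J.
have : nbhs x [set y : sub_space B | forall j, j \in J -> val y j = val x j] :=
  @initial_continuous _ (power_space M I) set_val x _ xJ.
by apply: filterS => y; exact: JU.
Qed.

Lemma continuous_sub_space I (B : substructure (power N I)) (X : topologicalType)
    (f : X -> sub_space B) :
  (forall i, continuous ((fun x => val (f x) i) : X -> discrete_topology M)) ->
  continuous f.
Proof.
move=> fc x U /nbhs_sub_space[J JU].
suff : \forall y \near x, forall j, j \in J -> val (f y) j = val (f x) j.
  by apply: filterS => y /JU.
elim: J {JU} => [|j J IH]; first by apply: filterS filterT.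
have nj : \forall y \near x, val (f y) j = val (f x) j :=
  fc j x _ (@discrete_set1 (discrete_topology M) (val (f x) j)).
apply: filterS (filterI nj IH) => y [/= yj yJ] k.
by rewrite in_cons => /orP[/eqP ->|/yJ].
Qed.

Lemma continuous_finite_exponent I (B : substructure (power N I))
    (X : topologicalType) (f : sub_space B -> X) :
  finite_set [set: I] -> continuous f.
Proof.
move=> /finite_setT_ex_seq[J JI] x U /nbhs_singleton Ux.
apply/nbhs_sub_space; exists J => y yE.
by have -> : y = x by apply/val_inj/funext => i; exact: yE.
Qed.

End Space.

Lemma closed_finite_exponent (M : finType) I (B : set (power_space M I)) :
  finite_set [set: I] -> closed B.
Proof.
move=> /finite_setT_ex_seq[J JI] x clx.
have [|y [By yE]] := clx [set f | forall j, j \in J -> f j = x j].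
  by apply/nbhs_power_space; exists J.
by have <- : y = x by apply/funext => i; exact: yE.
Qed.

(** * Finiteness of sets of maps and of subsets *)

Lemma finite_setT_inj T (K : finType) (f : T -> K) :
  injective f -> finite_set [set: T].
Proof.
move=> fi; rewrite -(preimage_setT f); apply: finite_preimage;
  last exact: finite_finset.
by move=> x y _ _; exact: fi.
Qed.

Lemma finite_setT_map T (M : finType) :
  finite_set [set: T] -> finite_set [set: T -> M].
Proof.
move=> /finite_setT_ex_seq[J JT].
apply: (@finite_setT_inj _ {ffun 'I_(size J) -> M}
  (fun f => [ffun i => f (tnth (in_tuple J) i)])).
move=> f g /ffunP fg; apply/funext => t.
have /tnthP[i ->] : t \in in_tuple J by exact: JT.
by have := fg i; rewrite !ffunE.
Qed.

Lemma finite_setT_set_type T (B : set T) :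
  finite_set [set: T] -> finite_set [set: B].
Proof.
move=> fT; rewrite -(preimage_setT (set_val : B -> T)).
by apply: finite_preimage => // x y _ _; exact: val_inj.
Qed.

Lemma substructure_eq S T (A : structure S T) (B C : substructure A) :
  B = C :> set T -> B = C.
Proof.
case: B C => [B clB] [C clC] /= BC; case: _ / BC clC => clC.
by congr Substructure; exact: Prop_irrelevance.
Qed.

(** * Interpolation of homomorphisms by evaluations *)

Section Interpolation.
Context S1 S2 (M : finType) (M1 : structure S1 M) (M2 : structure S2 M).
Variable c : compatible M1 M2.

(** For finite [A], this is surjectivity of the evaluation into the double dual, without topology
    because every map on the finite dual is continuous. *)
Definition represented T (A : structure S1 T) :=
  forall alpha : homs c A -> M, hom (homs c A) M2 alpha ->
    exists a, forall x, alpha x = val x a.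

Section Image.
Context T (A : structure S1 T) (n : nat) (y : 'I_n -> T -> M).
Hypothesis yP : forall i, hom A M1 (y i).

Lemma image_op_closed : op_closed (power M1 'I_n) (range (fun t i => y i t)).
Proof.
move=> g xs xsP.
have /choice[t tE] : forall k, exists t, (fun i => y i t) = xs k.
  by move=> k; have [t _ tE] := xsP k; exists t.
exists (op_of A g t) => //; apply/funext => i /=.
by rewrite (yP i).1; congr (op_of M1 _ _); apply/funext => k /=; rewrite -tE.
Qed.

Definition image : substructure (power M1 'I_n) := Substructure image_op_closed.

Definition to_image (t : T) : image :=
  exist _ (fun i => y i t) (mem_set (imageT _ t)).

Lemma to_image_hom : hom A image to_image.
Proof.
split=> [g xs|r xs rxs]; last by move=> i /=; exact: (yP i).2.
by apply/val_inj/funext => i /=; rewrite (yP i).1.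
Qed.

Lemma to_image_surj (b : image) : exists t, to_image t = b.
Proof. by have [t _ tE] := set_valP b; exists t; apply: val_inj. Qed.

End Image.

Lemma comp_hom S T U V (A : structure S T) (B : structure S U)
    (C : structure S V) (f : T -> U) (g : U -> V) :
  hom A B f -> hom B C g -> hom A C (g \o f).
Proof.
move=> [fop frel] [gop grel]; split=> [h xs|r xs /frel/grel//].
by rewrite /= fop gop.
Qed.

(** [H] abstracts [homs c A] and [chomts c A]; [Hcomp] asks that homomorphisms factoring through
    finitely many members of [H] stay in [H]. The map [T -> B] in the next hypothesis lets a point
    of [T] witness that [B] is non-empty. *)
Lemma interpolation T (A : structure S1 T) (H : substructure (power M2 T))
    (L : seq {classic H}) (alpha : H -> M) :
  (forall x : H, hom A M1 (val x)) ->
  (forall n (y : 'I_n -> H) (B : set ('I_n -> M)) (p : T -> B) (q : B -> M),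
    (forall t i, val (p t) i = val (y i) t) -> hom A M1 (q \o p) ->
    sub_set H (q \o p)) ->
  (forall B : substructure (power M1 'I_(size L)), (T -> B) -> represented B) ->
  hom H M2 alpha ->
  exists t, forall x : H, (x : {classic H}) \in L -> alpha x = val x t.
Proof.
move=> Hhom Hcomp rep [aop arel].
pose y i : H := tnth (in_tuple L) i.
have yP i : hom A M1 (val (y i)) := Hhom (y i).
pose B := image yP; pose p : T -> B := to_image yP.
have Hq (q : homs c B) : sub_set H (val q \o p).
  apply: (Hcomp _ y) => //.
  by apply: comp_hom (to_image_hom yP) _; exact: (set_valP q).
pose up (q : homs c B) : H := exist _ (val q \o p) (mem_set (Hq q)).
have [b bE] : exists b : B, forall q : homs c B, alpha (up q) = val q b.
  apply: (rep B p (alpha \o up)); split=> [g qs|r qs rqs] /=.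
    by rewrite -aop; congr alpha; apply: val_inj.
  by apply: arel => t; exact: rqs.
have [t tE] := to_image_surj b; exists t => x xL.
have /tnthP[i xE] : (x : {classic H}) \in in_tuple L by [].
pose q : homs c B := exist _ (fun b : B => val b i)
  (mem_set (@evaluation_hom _ _ _ _ B i)).
have -> : x = up q by apply: val_inj; rewrite xE.
by rewrite bE -tE.
Qed.

(** Each instance of preservation involves finitely many coordinates, on which a point of the
    closure coincides with an evaluation. The converse inclusion is the assumed density. *)
Lemma nat_ext_homs T (A : structure S1 T) :
  (forall (alpha : homs c A -> M) (L : seq {classic homs c A}),
    hom (homs c A) M2 alpha ->
    exists t, forall x : homs c A, (x : {classic homs c A}) \in L ->
      alpha x = val x t) ->
  nat_ext c A = [set alpha | hom (homs c A) M2 alpha] :> set _.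
Proof.
move=> interp; apply/seteqP; split=> [alpha cl|alpha /interp dense]; last first.
  move=> U /nbhs_power_space[L LU]; have [t tE] := dense L.
  exists (fun x => val x t); split; first by exists t.
  by apply: LU => x /tE.
have {}cl (L : seq {classic homs c A}) :
    exists t, forall x : homs c A, (x : {classic homs c A}) \in L ->
      alpha x = val x t.
  have [|_ [[t _ <-] tE]] := cl [set f | forall x, x \in L -> f x = alpha x].
    by apply/nbhs_power_space; exists L.
  by exists t => x /tE.
split=> [g xs|r xs rxs].
  have [t tE] := cl (op_of (homs c A) g xs ::
    [seq (xs k : {classic _}) | k <- enum 'I_(op_arity g)]).
  rewrite tE ?mem_head //=; congr (op_of M2 _ _); apply/funext => k /=.
  by rewrite tE // in_cons map_f ?orbT // mem_enum.
have [t tE] := cl [seq (xs k : {classic _}) | k <- enum 'I_(rel_arity r)].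
have -> : alpha \o xs = (fun k => val (xs k) t).
  by apply/funext => k /=; rewrite tE // map_f // mem_enum.
exact: rxs.
Qed.

End Interpolation.

Lemma top_iso_id S (X : topologicalType) (A : structure S X) : top_iso A A id.
Proof.
have idP : hom A A id by split.
have idc : continuous (id : X -> X) by move=> x; exact: cvg_id.
by split=> //; exists id; split.
Qed.

(** * Full duality on finite structures and the resulting interpolation *)

Section FiniteDuality.
Context S1 S2 (M : finType) (M1 : structure S1 M) (M2 : structure S2 M).
Variables (c : compatible M1 M2) (full : full_duality_discrete_M2 c).
Let c' := compatible_sym c.

Lemma finite_power n : finite_set [set: 'I_n -> M].
Proof. exact: finite_setT_map. Qed.

Lemma represented_M1 n (B : substructure (power M1 'I_n)) :
  B !=set0 -> represented c B.
Proof.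
move=> B0 alpha alphaP.
have isoB : exists f : B -> B, iso B B f.
  by exists id; split; [split | exists id; split; [by [] | by [] | split]].
have [|_ [g [_ gK _]]] := full.1 _ (induced B).
  by exists 'I_n, B; split.
have ca : continuous (alpha : sub_space (D c B) -> discrete_topology M).
  by apply: continuous_finite_exponent; exact/finite_setT_set_type/finite_power.
pose a : E c (DT c B) := exist _ alpha (mem_set (conj alphaP ca)).
by exists (g a) => x; have /(congr1 (fun e => val e x)) := gK a.
Qed.

(** [IS0cPplus] admits empty structures but only non-empty exponents, whence [0 < n] here where
    [represented_M1] has [B !=set0]. *)
Lemma represented_M2 n (B : substructure (power M2 'I_n)) :
  (0 < n)%N -> represented c' B.
Proof.
move=> n0 alpha [aop arel].
pose BT : structure S2 (sub_space B) := B.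
have isoB : exists f : sub_space B -> sub_space B, top_iso BT BT f.
  by exists id; exact: top_iso_id.
have [|_ _ [g [_ gK _ _]]] := full.2 (sub_space B) BT.
  exists 'I_n, B; split=> //; first by exists (Ordinal n0).
  exact: closed_finite_exponent.
(* Homomorphisms on the finite [B] are all continuous, so [inc] identifies the two duals and [alpha]
   can be transported. *)
pose inc (e : E c BT) : homs c' B :=
  exist _ (val e) (mem_set (set_valP e).1).
have incP : hom (E c BT) M1 (alpha \o inc).
  split=> [h es|r es res] /=; last exact: arel.
  by rewrite -aop; congr alpha; apply: val_inj.
pose a : D c (E c BT) := exist _ (alpha \o inc) (mem_set incP).
exists (g a) => x.
have cx : continuous (val x : sub_space B -> discrete_topology M).
  exact: continuous_finite_exponent.
pose e : E c BT :=
  exist _ (val x) (mem_set (conj (set_valP x) cx)).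
have -> : x = inc e by apply: val_inj.
by have /(congr1 (fun a => val a e)) := gK a.
Qed.

Lemma interpolation_homs_M1 T (A : structure S1 T) (t0 : T)
    (alpha : homs c A -> M) (L : seq {classic homs c A}) :
  hom (homs c A) M2 alpha ->
  exists t, forall x : homs c A, (x : {classic homs c A}) \in L ->
    alpha x = val x t.
Proof.
apply: (@interpolation _ _ _ M1 M2 c) => [x|n y B p q _ qP|B p].
- exact: (set_valP x).
- exact: qP.
- by apply: represented_M1; exists (val (p t0)); exact: set_valP.
Qed.

Lemma interpolation_chomts (X : topologicalType) (A : structure S1 X) (t0 : X)
    (alpha : chomts c A -> M) (L : seq {classic chomts c A}) :
  hom (chomts c A) M2 alpha ->
  exists t, forall x : chomts c A, (x : {classic chomts c A}) \in L ->
    alpha x = val x t.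
Proof.
apply: (@interpolation _ _ _ M1 M2 c) => [x|n y B p q pE qp|B p].
- exact: (set_valP x).1.
(* Near [x] the finitely many [y i] are constant, hence so is [p]; thus [q \o p] is continuous for
   any [q]. *)
- split=> // x; apply/discrete_cvg.
  have : \forall z \near x, forall i, val (y i) z = val (y i) x.
    apply: filter_forall => i.
    have [_ yc] := set_valP (y i).
    exact: yc x _ (@discrete_set1 (discrete_topology M) (val (y i) x)).
  apply: filterS => z zE /=; congr q; apply/val_inj/funext => i.
  by rewrite !pE zE.
- by apply: represented_M1; exists (val (p t0)); exact: set_valP.
Qed.

Lemma interpolation_homs_M2 T (X : structure S2 T) (h0 : homs c' X)
    (beta : homs c' X -> M) (L : seq {classic homs c' X}) :
  hom (homs c' X) M1 beta ->
  exists t, forall h : homs c' X, (h : {classic homs c' X}) \in L ->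
    beta h = val h t.
Proof.
move=> betaP.
(* Putting [h0] in front makes the exponent [size L] positive. *)
have [||B _|//|t tE] := @interpolation _ _ _ _ _ c' _ X (homs c' X)
    ((h0 : {classic homs c' X}) :: L) beta.
- by move=> x; exact: (set_valP x).
- by move=> n y B p q _.
- exact: represented_M2.
by exists t => h hL; apply: tE; rewrite in_cons hL orbT.
Qed.

End FiniteDuality.

(** * Factoring continuous homomorphisms through finite substructures *)

Section ContinuousHoms.
Context S1 S2 (M : finType) (M1 : structure S1 M) (M2 : structure S2 M).
Variables (c' : compatible M2 M1) (T : Type) (X : structure S2 T).
Let GX := homs c' X.
Hypothesis separated : forall z t, (forall h : GX, val h z = val h t) -> z = t.
Variable h0 : GX.

Definition agree_on (J : seq {classic T}) (f g : T -> M) :=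
  forall j, (j : {classic T}) \in J -> f j = g j.

(* The coordinatewise view: in M2^(G X), these are the elements whose value at
   each coordinate h is a function of the restriction of h to J. There are only
   finitely many of them, and they form a substructure whatever the size of the
   signature, so no generated substructure is needed. *)
Definition determined (J : seq {classic T}) : set T :=
  [set z | forall h h' : GX, agree_on J (val h) (val h') -> val h z = val h' z].

Lemma determined_op_closed J : op_closed X (determined J).
Proof.
move=> g zs zsP h h' hh'; rewrite (set_valP h).1 (set_valP h').1.
by congr (op_of M2 _ _); apply/funext => k; exact: zsP.
Qed.

Definition determined_sub (J : seq {classic T}) : substructure X :=
  Substructure (@determined_op_closed J).

Lemma mem_determined J (j : T) : (j : {classic T}) \in J -> determined J j.
Proof. by move=> jJ h h'; exact. Qed.

Lemma finite_determined J : finite_set [set: determined_sub J].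
Proof.
pose res (h : GX) : {ffun 'I_(size J) -> M} :=
  [ffun i => val h (tnth (in_tuple J) i)].
(* [rep p] is a homomorphism with restriction [p], or the default [h0] if there is none; the values
   at these representatives fix an element. *)
pose rep p := xget h0 [set h | res h = p].
apply: (@finite_setT_inj _ {ffun {ffun 'I_(size J) -> M} -> M}
  (fun z => [ffun p => val (rep p) (val z)])).
move=> z t /ffunP zt; apply/val_inj/separated => h.
have /ffunP E : res (rep (res h)) = res h :=
  @xgetPex _ h0 [set h' | res h' = res h] (ex_intro _ h erefl).
have hh : agree_on J (val h) (val (rep (res h))).
  move=> j jJ; have /tnthP[i ->] : (j : {classic T}) \in in_tuple J by [].
  by have := E i; rewrite !ffunE.
rewrite (set_valP z _ _ hh) (set_valP t _ _ hh).
by have := zt (res h); rewrite !ffunE.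
Qed.

(** The extension need not be a homomorphism: it only places maps with varying domains in the single
    space [T -> M], where the lifting argument takes its limit. *)
Lemma ex_hom_extension J (g : homs c' (determined_sub J)) :
  exists f : T -> M, forall z : determined_sub J, f (val z) = val g z.
Proof.
exists (fun z => if pselect (determined J z) is left p
  then val g (exist _ z (mem_set p)) else val h0 z) => z.
case: pselect => [p|[]]; last exact: set_valP.
by congr (val g _); apply: val_inj.
Qed.

(* By compactness: otherwise partial homomorphisms on larger and larger finite
   subsets, none of them liftable, would cluster at a homomorphism on X which
   lifts one of them. *)
Lemma lift_determined J0 k (R : set ('I_k -> M)) :
  exists J1 : seq {classic T}, forall (J : seq {classic T}) (g : 'I_k -> T -> M),
    {subset J1 <= J} ->
    (forall i, hom (determined_sub J) M2 (fun z => g i (val z))) ->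
    (forall z : determined_sub J, R (fun i => g i (val z))) ->
    exists2 h : 'I_k -> GX, forall z, R (fun i => val (h i) z) &
      forall i, agree_on J0 (val (h i)) (g i).
Proof.
apply: contrapT => /forallNP nJ.
have /choice[Jg JgP] : forall J1 : seq {classic T},
    exists Jg : seq {classic T} * ('I_k -> T -> M),
    [/\ {subset J1 <= Jg.1},
        forall i, hom (determined_sub Jg.1) M2 (fun z => Jg.2 i (val z)),
        forall z : determined_sub Jg.1, R (fun i => Jg.2 i (val z)) &
        ~ exists2 h : 'I_k -> GX, forall z, R (fun i => val (h i) z) &
          forall i, agree_on J0 (val (h i)) (Jg.2 i)].
  move=> J1; apply: contrapT => H; apply: (nJ J1) => J g J1J gP gR.
  by apply: contrapT => nh; apply: H; exists (J, g).
(* The [k] maps cluster jointly, as one point of a power of [M], so that [R] passes to the limit. *)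
have [w0 w0P] := @power_space_cluster M T ('I_k * T)
  (fun J ij => (Jg J).2 ij.1 ij.2).
have near_w0 (J : seq {classic T}) (L : seq {classic T}) : exists J',
    {subset J <= (Jg J').1} /\
    forall i (z : T), (z : {classic T}) \in L -> (Jg J').2 i z = w0 (i, z).
  have [J' JJ' w0E] := w0P J [seq ((i, z) : {classic 'I_k * T})
    | i : 'I_k <- enum 'I_k, z : {classic T} <- L].
  exists J'; split=> [j /JJ'|i z zL]; first by have [+ _ _ _] := JgP J'; exact.
  by apply: (w0E (i, z)); apply: allpairs_f; rewrite ?mem_enum.
have w0hom i : hom X M2 (fun z => w0 (i, z)).
  split=> [g zs|r zs rzs].
    pose zl := [seq (zs k : {classic T}) | k <- enum 'I_(op_arity g)].
    have [J' [sJ w0E]] := near_w0 zl ((op_of X g zs : {classic T}) :: zl).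
    have zsl j : (zs j : {classic T}) \in zl by rewrite map_f // mem_enum.
    have [_ /(_ i)[gop _] _ _] := JgP J'.
    pose zs' j : determined_sub (Jg J').1 :=
      exist _ (zs j) (mem_set (mem_determined (sJ _ (zsl j)))).
    rewrite -w0E ?mem_head //; have /= -> := gop g zs'.
    congr (op_of M2 _ _); apply/funext => j /=.
    by rewrite w0E // in_cons zsl orbT.
  pose zl := [seq (zs k : {classic T}) | k <- enum 'I_(rel_arity r)].
  have [J' [sJ w0E]] := near_w0 zl zl.
  have zsl j : (zs j : {classic T}) \in zl by rewrite map_f // mem_enum.
  have [_ /(_ i)[_ grel] _ _] := JgP J'.
  pose zs' j : determined_sub (Jg J').1 :=
    exist _ (zs j) (mem_set (mem_determined (sJ _ (zsl j)))).
  have := grel r zs' rzs; congr (rel_of M2 r _); apply/funext => j /=.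
  exact: w0E.
pose h i : GX := exist _ (fun z => w0 (i, z)) (mem_set (w0hom i)).
(* On [J0] the limit [h] coincides with the maps chosen for some [J'], so it lifts them, contrary to
   their choice. *)
have [J' [_ w0E]] := near_w0 [::] J0.
have [_ _ _ []] := JgP J'; exists h => [z|i j jJ]; last by rewrite /= w0E.
have [J2 [sJ w0E2]] := near_w0 [:: (z : {classic T})] [:: (z : {classic T})].
have zJ := mem_determined (sJ _ (mem_head _ _)).
have [_ _ /(_ (exist _ z (mem_set zJ))) + _] := JgP J2.
by congr R; apply/funext => i /=; rewrite w0E2 ?mem_head.
Qed.

Variable u : GX -> M.
Hypothesis uhom : hom GX M1 u.
Hypothesis uc : continuous (u : sub_space GX -> discrete_topology M).

(** Otherwise pairs separated by [u] but agreeing on larger and larger finite sets would cluster at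
    a homomorphism, near which [u] is constant. *)
Lemma continuous_finite_support : exists J0 : seq {classic T},
  forall h h' : GX, agree_on J0 (val h) (val h') -> u h = u h'.
Proof.
apply: contrapT => /forallNP nJ.
have /choice[hh hhP] : forall J : seq {classic T}, exists hh : GX * GX,
    agree_on J (val hh.1) (val hh.2) /\ u hh.1 <> u hh.2.
  move=> J; apply: contrapT => H; apply: (nJ J) => h h' hh'.
  by apply: contrapT => ne; apply: H; exists (h, h').
have [w0 w0P] := power_space_cluster (fun J => val (hh J).1).
have w0hom : hom X M2 w0.
  split=> [g zs|r zs rzs].
    have [J' _ w0E] := w0P [::] ((op_of X g zs : {classic T}) ::
      [seq (zs k : {classic T}) | k <- enum 'I_(op_arity g)]).
    rewrite -w0E ?mem_head // (set_valP (hh J').1).1.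
    congr (op_of M2 _ _); apply/funext => j /=.
    by rewrite w0E // in_cons map_f ?orbT // mem_enum.
  have [J' _ w0E] := w0P [::]
    [seq (zs k : {classic T}) | k <- enum 'I_(rel_arity r)].
  have := (set_valP (hh J').1).2 r zs rzs; congr (rel_of M2 r _).
  by apply/funext => j /=; apply: w0E; rewrite map_f // mem_enum.
pose h : GX := exist _ w0 (mem_set w0hom).
have /nbhs_sub_space[L LE] :=
  uc (x := h) (@discrete_set1 (discrete_topology M) (u h)).
have [J LJ w0E] := w0P L L.
have [hhJ] := hhP J; rewrite (LE (hh J).1); last by move=> j /w0E.
by rewrite (LE (hh J).2) // => j jL; rewrite -hhJ ?w0E //; exact: LJ.
Qed.

Lemma continuous_hom_factor : finite_set [set: rels S1] ->
  exists (J : seq {classic T}) (v : homs c' (determined_sub J) -> M),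
    hom (homs c' (determined_sub J)) M1 v /\
    forall (h : GX) (g : homs c' (determined_sub J)),
      (forall z : determined_sub J, val g z = val h (val z)) -> u h = v g.
Proof.
move=> /finite_setT_ex_seq[rs rsP].
have [J0 J0P] := continuous_finite_support.
have /choice[Jr JrP] := fun r : rels S1 => @lift_determined J0 _ (rel_of M1 r).
have [J1 J1P] := @lift_determined J0 1 setT.
(* [J0] supports [u], [J1] provides lifts of single maps, and [Jr r] provides joint lifts that
   respect the relation [r]. *)
pose J := J0 ++ J1 ++ flatten [seq Jr r | r : {classic rels S1} <- rs].
have sJ0 : {subset J0 <= J} by move=> j jJ; rewrite mem_cat jJ.
have sJ1 : {subset J1 <= J} by move=> j jJ; rewrite !mem_cat jJ orbT.
have sJr r : {subset Jr r <= J}.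
  move=> j jJ; rewrite !mem_cat; apply/orP; right; apply/orP; right.
  by apply/flattenP; exists (Jr r) => //; apply: map_f.
have /choice[ext extE] := @ex_hom_extension J.
have extP g : hom (determined_sub J) M2 (fun z => ext g (val z)).
  have -> : (fun z : determined_sub J => ext g (val z)) = val g by apply/funext.
  exact: (set_valP g).
have /choice[lift liftP] : forall g, exists h : GX, agree_on J0 (val h) (ext g).
  move=> g; have [i|//|h _ hE] := J1P J (fun=> ext g) sJ1.
    exact: extP.
  by exists (h ord0); exact: hE.
have uE g (h : GX) : agree_on J0 (val h) (ext g) -> u h = u (lift g).
  by move=> hg; apply: J0P => j jJ; rewrite hg // liftP.
have inJ j : (j : {classic T}) \in J0 -> determined J j.
  by move=> jJ; apply: mem_determined; exact: sJ0.
exists J, (u \o lift); split; last first.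
  move=> h g gh; apply: uE => j jJ.
  have zJ := mem_set (inJ _ jJ).
  by rewrite -[j]/(val (exist _ j zJ : determined_sub J)) extE gh.
split=> [f gs|r gs rgs] /=.
  (* An operation applied to lifts agrees on [J0] with the operation applied to the lifted maps, so
     operations require no enlargement of [J]. *)
  rewrite -[RHS]uhom.1; apply/esym/uE => j jJ.
  have zJ := mem_set (inJ _ jJ).
  rewrite -[j]/(val (exist _ j zJ : determined_sub J)) extE /=.
  congr (op_of M1 _ _); apply/funext => k.
  by rewrite -extE /= liftP.
(* The separately chosen [lift (gs i)] may fail to be related; the joint lifts [h] are related and
   have the same images under [u]. *)
have [||h hR hE] := JrP r J (fun i => ext (gs i)) (sJr r) _ _.
- by move=> i; exact: extP.
- move=> z; have := rgs z; congr (rel_of M1 r _).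
  by apply/funext => k; rewrite extE.
have := uhom.2 r h hR; congr (rel_of M1 r _).
by apply/funext => k /=; exact/uE/hE.
Qed.

End ContinuousHoms.

(** * The partner duality and the natural extensions *)

Section Partner.
Context S1 S2 (M : finType) (M1 : structure S1 M) (M2 : structure S2 M).
Variables (c : compatible M1 M2) (full : full_duality_discrete_M2 c).
Let c' := compatible_sym c.

(** On each finite [L], [alpha] is the evaluation at some [a L]; a limit of these points, taken in
    the closed set [B], serves all of [F c A]. *)
Lemma eval_GF_surj (X : topologicalType) (A : structure S1 X) :
  IScP M1 A -> forall alpha : G c (F c A), exists a, eval_GF c A a = alpha.
Proof.
move=> [I [B [[b Bb] clB [f [fhom fc [e [fK eK _ ec]]]]]]] alpha.
have t0 : X := e (exist _ b (mem_set Bb)).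
have /choice[a aP] : forall L : seq {classic F c A}, exists t,
    forall x : F c A, (x : {classic F c A}) \in L -> val alpha x = val x t.
  by move=> L; apply: (interpolation_chomts full t0); exact: (set_valP alpha).
have [w0 w0P] := power_space_cluster (fun L => val (f (a L))).
have Bw0 : sub_set B w0.
  apply: clB => U /nbhs_power_space[L LU].
  have [J _ JE] := w0P [::] L.
  by exists (val (f (a J))); split; [exact: set_valP | exact: LU].
pose b0 : sub_space B := exist _ w0 (mem_set Bw0).
exists (e b0); apply/val_inj/funext => x /=.
have [_ xc] := set_valP x.
(* [x \o e] is constant on the neighbourhood of [b0] given by [L], which contains [f (a J)] for some
   [J] with [x] in it. *)
have /(ec b0)/nbhs_sub_space[L LE] :=
  xc (e b0) _ (@discrete_set1 (discrete_topology M) (val x (e b0))).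
have [J sJ JE] := w0P [:: (x : {classic F c A})] L.
rewrite (aP J) ?sJ ?mem_head //.
by have /= := LE (f (a J)) JE; rewrite fK.
Qed.

(** The coordinates of an embedding into a power of [M1] belong to [F c A], so evaluations recover
    the points, relations and topology of [A]. *)
Lemma eval_GF_top_iso (X : topologicalType) (A : structure S1 X) :
  IScP M1 A -> top_iso A (GT c (F c A)) (eval_GF c A).
Proof.
move=> IScPA; have /choice[inv invK] := eval_GF_surj IScPA.
have [I [B [_ _ [f [fhom fc [e [fK eK ehom ec]]]]]]] := IScPA.
have coord_chom i : hom A M1 (fun t => val (f t) i) /\
    continuous ((fun t => val (f t) i) : X -> discrete_topology M).
  split; first exact: (comp_hom fhom (@evaluation_hom _ _ _ _ B i)).
  move=> t; apply: (@continuous_comp X (sub_space B) (discrete_topology M) f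
    (fun b => val b i)); first exact: fc.
  exact: evaluation_continuous.
pose coord i : F c A := exist _ (fun t => val (f t) i) (mem_set (coord_chom i)).
have f_inv alpha i : val (f (inv alpha)) i = val alpha (coord i).
  by rewrite -[in RHS](invK alpha).
have injE t t' : eval_GF c A t = eval_GF c A t' -> t = t'.
  move=> tt'; apply: (can_inj fK); apply/val_inj/funext => i.
  by have := congr1 (fun al => val al (coord i)) tt'.
have ehomA : hom A (G c (F c A)) (eval_GF c A).
  split=> [g xs|r xs rxs].
    by apply/val_inj/funext => x /=; rewrite (set_valP x).1.1.
  by move=> x /=; exact: (set_valP x).1.2.
split=> //.
  apply: continuous_sub_space => x.
  exact: (set_valP x).2.
exists inv; split=> // [t||].
- by apply: injE; rewrite invK.
- split=> [g als|r als ral].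
    apply: injE; rewrite invK ehomA.1; congr op_of.
    by apply/funext => k /=; rewrite invK.
  have rB : rel_of B r (f \o inv \o als).
    move=> i; have := ral (coord i); congr (rel_of M1 r _).
    by apply/funext => k /=; rewrite f_inv.
  have := ehom.2 r _ rB; congr (rel_of A r _).
  by apply/funext => k /=; rewrite fK.
- have -> : inv = e \o (f \o inv) by apply/funext => al /=; rewrite fK.
  move=> al; apply: (@continuous_comp (sub_space (G c (F c A))) (sub_space B) X
    (f \o inv) e);
    last exact: ec.
  apply: continuous_sub_space => i {}al.
  have -> : (fun al => val (f (inv al)) i) = (fun al => val al (coord i)).
    by apply/funext => al'; rewrite f_inv.
  exact: (@evaluation_continuous _ _ _ _ (G c (F c A)) (coord i)).
Qed.

(** The coordinates of an embedding already separate points and detect relations. Since the exponent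
    is non-empty, there is a coordinate even for empty [X]. *)
Lemma IS0Pplus_coordinates T (X : structure S2 T) : IS0Pplus M2 X ->
  [/\ inhabited (G c X),
      forall z t, (forall h : G c X, val h z = val h t) -> z = t &
      forall (r : rels S2) xs,
        (forall h : G c X, rel_of M2 r (val h \o xs)) -> rel_of X r xs].
Proof.
move=> [I [B [[i0 _] [f [fhom [e [fK eK ehom]]]]]]].
have coord_hom i : hom X M2 (fun t => val (f t) i).
  exact: (comp_hom fhom (@evaluation_hom _ _ _ _ B i)).
pose coord i : G c X := exist _ (fun t => val (f t) i) (mem_set (coord_hom i)).
split=> [|z t zt|r xs hxs]; first exact: (inhabits (coord i0)).
  by apply: (can_inj fK); apply/val_inj/funext => i; exact: (zt (coord i)).
have rB : rel_of B r (f \o xs) by move=> i; exact: (hxs (coord i)).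
have := ehom.2 r _ rB; congr (rel_of X r _).
by apply/funext => k /=; rewrite fK.
Qed.

Lemma eval_FG_surj T (X : structure S2 T) : finite_type S1 ->
  IS0Pplus M2 X -> forall u : F c (GT c X), exists z, eval_FG c X z = u.
Proof.
move=> [_ fin_rels] /IS0Pplus_coordinates[[h0] sep _] u.
have [uhom uc] := set_valP u.
have [J [v [vhom uv]]] := continuous_hom_factor h0 uhom uc fin_rels.
have resP (h : G c X) : hom (determined_sub c' X J) M2 (fun z => val h (val z)).
  by split=> [g xs|r xs rxs]; [exact: (set_valP h).1 | exact: (set_valP h).2].
pose res h : homs c' (determined_sub c' X J) :=
  exist _ (fun z => val h (val z)) (mem_set (resP h)).
have /finite_setT_ex_seq[L LP] :
    finite_set [set: homs c' (determined_sub c' X J)].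
  exact/finite_setT_set_type/finite_setT_map/(finite_determined sep h0).
(* [L] lists all homomorphisms on the finite substructure, so [v] is everywhere the evaluation at
   [z]. *)
have [z zE] := interpolation_homs_M2 full (res h0) L vhom.
exists (val z); apply/val_inj/funext => h /=.
by rewrite (uv h (res h)) // zE.
Qed.

Lemma eval_FG_iso T (X : structure S2 T) : finite_type S1 ->
  IS0Pplus M2 X -> iso X (F c (GT c X)) (eval_FG c X).
Proof.
move=> fin IX; have /choice[inv invK] := eval_FG_surj fin IX.
have [_ sep rel] := IS0Pplus_coordinates IX.
have ehom : hom X (F c (GT c X)) (eval_FG c X).
  split=> [g xs|r xs rxs].
    by apply/val_inj/funext => h /=; rewrite (set_valP h).1.
  by move=> h /=; exact: (set_valP h).2.
have injE z t : eval_FG c X z = eval_FG c X t -> z = t.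
  move=> zt; apply: sep => h.
  by have := congr1 (fun u => val u h) zt.
split=> //; exists inv; split=> // [z|].
  by apply: injE; rewrite invK.
split=> [g us|r us rus].
  apply: injE; rewrite invK ehom.1; congr op_of.
  by apply/funext => k /=; rewrite invK.
apply: rel => h; have := rus h; congr (rel_of M2 r _).
by apply/funext => k /=; rewrite -[in LHS](invK (us k)).
Qed.

Lemma n_A_homs T (A : structure S1 T) : ISP M1 A ->
  n_A c A = [set alpha : D c A -> M | hom (D c A) M2 alpha] :> set _.
Proof.
move=> [I [B [[b Bb] [f [_ [e _]]]]]].
apply: nat_ext_homs => alpha L; apply: interpolation_homs_M1 => //.
exact: (e (exist _ b (mem_set Bb))).
Qed.

Lemma n_X_homs T (X : structure S2 T) : IS0Pplus M2 X ->
  n_X c X = [set beta : G c X -> M | hom (G c X) M1 beta] :> set _.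
Proof.
move=> /IS0Pplus_coordinates[[h0] _ _].
by apply: nat_ext_homs => beta L; exact: interpolation_homs_M2.
Qed.

End Partner.

Theorem corollary6p2 (S1 S2 : signature) (M : finType)
    (M1 : structure S1 M) (M2 : structure S2 M)
    (M1_finite_type : finite_type S1) (c : compatible M1 M2)
    (M2T_full : full_duality_discrete_M2 c) :
  full_duality_M2 c /\
  [/\ (* (1) *)
      (forall (T : Type) (A : structure S1 T), ISP M1 A ->
         n_A c A = G c (D c A)) /\
      (forall (T : Type) (X : structure S2 T), IS0Pplus M2 X ->
         n_X c X = D c (G c X)),
      (* (2) *)
      forall (T : Type) (A : structure S1 T), ISP M1 A ->
        n_A c A = [set alpha : D c A -> M | hom (D c A) M2 alpha] :> set _ &
      (* (3) *)
      forall (T : Type) (X : structure S2 T), IS0Pplus M2 X ->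
        n_X c X = [set beta : G c X -> M | hom (G c X) M1 beta] :> set _].
Proof.
split; first by split=> T A; [exact: eval_GF_top_iso | exact: eval_FG_iso].
split=> [|T A|T X]; last by exact: n_X_homs.
(* The carriers of [G c (D c A)] and [D c (G c X)] are by definition the sets in (2) and (3). *)
- split=> T A IA; apply: substructure_eq.
    by rewrite (n_A_homs M2T_full IA).
  by rewrite (n_X_homs M2T_full IA).
- exact: n_A_homs.
Qed.
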